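(* Let $(T_\xi)$ be a family of operators $T_\xi\colon\mathcal H\to\mathcal H$, with $\xi\sim\mathcal D$, such that $T_\xi$ is nonexpansive for $\mathcal D$-almost all $\xi$ and, for each $x\in\mathcal H$, the map $\xi\mapsto T_\xi x$ is measurable and Bochner integrable. Define $Tx=\mathbb E_{\xi\sim\mathcal D}[T_\xi x]$ and assume $\mathrm{Fix}(T)\neq\emptyset$. Assume that for some $p_0\in\mathrm{Fix}(T)$, $\mathbb E[\|(T_\xi-T)p_0\|^2]\le\sigma_*^2<+\infty$. Let $(\lambda_k)_{k\ge0}\subset(0,1)$, $x_0\in\mathcal H$, and let $(x_k)$ be the random iterates of the stochastic Krasnoselskii-Mann algorithm $x_{k+1}=(1-\lambda_k)x_k+\lambda_kT_{\xi_k}(x_k)$, where $\xi_0,\xi_1,\dots$ are drawn independently from $\mathcal D$. Then, for every $K\ge1$, $$\mathbb E\left[\|Tx_{N_K}-x_{N_K}\|^2\right]\le\frac{\mathrm{dist}(x_0,\mathrm{Fix}(T))^2+2\sum_{k=0}^{K-1}\lambda_k^2\sigma_*^2}{\Lambda_K\sum_{k=0}^{K-1}\lambda_k(1-\lambda_k)},$$ where $N_K$ is the random index defined in the context and $\mathbb E$ is taken over all sources of randomness. Moreover, if in addition $\sum_{k=0}^\infty\lambda_k^2<+\infty$ and $\sum_{k=0}^\infty\lambda_k=+\infty$, then, for $K\ge1$, $$\mathbb E\left[\|Tx_{N_K}-x_{N_K}\|\right]\le\mathcal O\left(\frac1{\sqrt{\sum_{k=0}^{K-1}\lambda_k(1-\lambda_k)}}\right)$$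 and, almost surely, $$\min_{k\le K-1}\|Tx_k-x_k\|\le o\left(\frac1{\sqrt{\sum_{k=0}^{K-1}\lambda_k(1-\lambda_k)}}\right).$$
   Context: $\mathcal H$ is a real separable Hilbert space with norm $\|\cdot\|$, and $\mathcal D$ is a probability distribution. An operator $S$ is nonexpansive if $\|Sx-Sy\|\le\|x-y\|$ for all $x,y\in\mathcal H$. $\mathrm{Fix}(T)=\{x\colon Tx=x\}$ and $\mathrm{dist}(x,F)=\inf_{p\in F}\|x-p\|$. The starting point $x_0$ is a fixed (deterministic) point. Define $\Lambda_k=\prod_{i=0}^{k-1}(1+2\lambda_i^2)^{-1}$. The random index $N_K\in\{0,\dots,K-1\}$ is independent of the algorithmic randomness $(\xi_k)$ and satisfies $$\mathbb P(N_K=k)=\frac{\Lambda_{k+1}\lambda_k(1-\lambda_k)}{\sum_{k'=0}^{K-1}\Lambda_{k'+1}\lambda_{k'}(1-\lambda_{k'})},\quad k=0,\dots,K-1.$$ The $\mathcal O$ constant does not depend on $K$; $o(\cdot)$ is understood as $K\to\infty$. *)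

(* Defs.v *)
From HB Require Import structures.
From mathcomp Require Import all_boot all_order all_algebra.
From mathcomp Require Import all_classical all_reals all_analysis.

Set Implicit Arguments.
Unset Strict Implicit.
Unset Printing Implicit Defensive.

Import Order.TTheory GRing.Theory Num.Theory.
Import numFieldNormedType.Exports.

Local Open Scope classical_set_scope.
Local Open Scope ring_scope.

Notation borelType V := (g_sigma_algebraType (@open V)).

Definition separable (V : topologicalType) :=
  exists2 S : set V, countable S & dense S.

Definition simple_fun d (X : measurableType d) (V : Type) (s : X -> V) :=
  finite_set (range s) /\ forall v, measurable (s @^-1` [set v]).

(* The measure is finite, so simple functions need no support condition. *)
Section bochner.
Context {R : realType} {V : normedModType R} {d : measure_display}
  {X : measurableType d}.
Variable mu : probability X R.

Definition simple_integral (s : X -> V) : V :=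
  \sum_(v \in range s) fine (mu (s @^-1` [set v])) *: v.

Definition strongly_measurable (f : X -> V) :=
  exists2 s : nat -> X -> V, (forall n, simple_fun (s n)) &
    {ae mu, forall x, s n x @[n --> \oo] --> f x}.

Definition bochner_approx (f : X -> V) (s : nat -> X -> V) :=
  (forall n, simple_fun (s n)) /\
  (\int[mu]_x (`|f x - s n x|)%:E)%E @[n --> \oo] --> 0%E.

Definition bochner_integrable (f : X -> V) :=
  strongly_measurable f /\ exists s, bochner_approx f s.

(* For a Bochner integrable f with values in a complete V, the set below is a
   singleton; otherwise the value is irrelevant. *)
Definition bochner_integral (f : X -> V) : V :=
  xget 0 [set v | exists2 s, bochner_approx f s &
                  simple_integral (s n) @[n --> \oo] --> v].

End bochner.

Section operators.
Context {R : realType} {V : normedModType R}.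

Definition nonexpansive (S : V -> V) := forall x y, `|S x - S y| <= `|x - y|.

Definition Fix (S : V -> V) : set V := [set x | S x = x].

Definition dist (x : V) (F : set V) : R := inf [set `|x - p| | p in F].

Definition mean_operator d (Xi : measurableType d) (D : probability Xi R)
  (T : Xi -> V -> V) (x : V) : V := bochner_integral D (T ^~ x).

Fixpoint km_iter (Xi : Type) (T : Xi -> V -> V) (lambda : nat -> R) (x0 : V)
    (z : nat -> Xi) (k : nat) : V :=
  if k is j.+1 then
    let x := km_iter T lambda x0 z j in
    (1 - lambda j) *: x + lambda j *: T (z j) x
  else x0.

End operators.

Definition Lambda (R : realType) (lambda : nat -> R) (k : nat) : R :=
  \prod_(i < k) (1 + 2 * lambda i ^+ 2)^-1.

(* The minimum of r 0, ..., r K.-1 for K > 0; the seed r 0 is then one of the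
   values. *)
Definition running_min (R : realType) (r : nat -> R) (K : nat) : R :=
  \big[Num.min/r 0%N]_(k < K) r k.

Section independence.
Context {R : realType} {d : measure_display} {Omega : measurableType d}.
Variable P : probability Omega R.

Definition mutually_independent d' (Xi : measurableType d')
    (X : nat -> {RV P >-> Xi}) :=
  forall (J : seq nat) (A : nat -> set Xi), uniq J ->
    (forall j, measurable (A j)) ->
    P (\bigcap_(j in [set` J]) (X j @^-1` A j)) =
    (\prod_(j <- J) P (X j @^-1` A j))%E.

Definition independent_sigma_algebras (F G : set (set Omega)) :=
  forall A B, F A -> G B -> P (A `&` B) = (P A * P B)%E.

Definition sigma_of_sequence d' (Xi : measurableType d')
    (X : nat -> {RV P >-> Xi}) : set (set Omega) :=
  <<s \bigcup_k g_sigma_algebra_preimage (X k) >>.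

End independence.

(* Main.v *)
Require Import Defs.
From HB Require Import structures.
From mathcomp Require Import all_boot all_order all_algebra.
From mathcomp Require Import all_classical all_reals all_analysis.
From mathcomp Require Import finmap measurable_realfun ring lra.
Import Order.TTheory GRing.Theory Num.Theory.
Import numFieldNormedType.Exports.
Local Open Scope classical_set_scope.
Local Open Scope ring_scope.

(* Write [M] for the mean operator and [r_k = |M x_k - x_k|].  Expanding the
   square of [x_(k+1) - p = (1 - l)(x_k - p) + l (M x_k - p) + l e], where the
   noise [e] is centred given [x_k] and has variance at most
   [2 |x_k - p| ^ 2 + 2 sigma ^ 2], gives
     E |x_(k+1) - p| ^ 2 + l (1 - l) E r_k ^ 2
       <= (1 + 2 l ^ 2) E |x_k - p| ^ 2 + 2 l ^ 2 sigma ^ 2.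
   The variance of [T_xi p] is the same at every fixed point [p], so the bound
   holds for all of them, which yields the distance to the fixed point set.
   Multiplying by [Lambda_(k+1)] makes the recurrence telescope.  When the
   [l_k ^ 2] are summable, [Lambda_k] is bounded below, hence
   [E (sum_k l_k (1 - l_k) r_k ^ 2)] is finite and the series converges almost
   surely; comparing its tails with the running minimum gives the last claim.
   Bochner integrals are only used through their inner products with vectors.
   On the null set where [T_xi] fails to be nonexpansive it is replaced by the
   identity, because measurability of the iterates needs every [T_xi] to be
   continuous; the integrals in the theorem are then lower integrals of
   functions that need not be measurable. *)

Set Implicit Arguments.
Unset Strict Implicit.

(** * Inner products *)

Section inner_product.
Context {R : realType} {H : normedModType R} (dot : {dot H for idfun}).

Lemma dotC x y : dot x y = dot y x.
Proof. by rewrite [LHS]hermitian_subproof expr0 mul1r. Qed.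

Lemma dotDr x y z : dot x (y + z) = dot x y + dot x z.
Proof. exact: linearDr. Qed.

Lemma dotNr x y : dot x (- y) = - dot x y.
Proof. exact: linearNr. Qed.

Lemma dotZr a x y : dot x (a *: y) = a * dot x y.
Proof. exact: linearZr_LR. Qed.

Lemma dotDl x y z : dot (x + y) z = dot x z + dot y z.
Proof. by rewrite !(dotC _ z) dotDr. Qed.

Lemma dotNl x y : dot (- x) y = - dot x y.
Proof. by rewrite !(dotC _ y) dotNr. Qed.

Lemma dotZl a x y : dot (a *: x) y = a * dot x y.
Proof. by rewrite !(dotC _ y) dotZr. Qed.

Hypothesis dotE : forall x, dot x x = `|x| ^+ 2.

Lemma norm_sqD x y : `|x + y| ^+ 2 = `|x| ^+ 2 + 2 * dot x y + `|y| ^+ 2.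
Proof. by rewrite -!dotE dotDl !dotDr (dotC y x); ring. Qed.

Lemma norm_sqB x y : `|x - y| ^+ 2 = `|x| ^+ 2 - 2 * dot x y + `|y| ^+ 2.
Proof. by rewrite norm_sqD dotNr normrN; ring. Qed.

(** The negative term is the source of the residual [|M x - x| ^ 2] in the one-step inequality. *)
Lemma norm_sq_convex (t : R) (x y : H) : `|(1 - t) *: x + t *: y| ^+ 2 =
  (1 - t) * `|x| ^+ 2 + t * `|y| ^+ 2 - t * (1 - t) * `|x - y| ^+ 2.
Proof. by rewrite norm_sqD norm_sqB -!dotE !dotZl !dotZr; ring. Qed.

Lemma norm_sqD_le (x y : H) : `|x + y| ^+ 2 <= 2 * `|x| ^+ 2 + 2 * `|y| ^+ 2.
Proof.
have : 0 <= `|x - y| ^+ 2 by rewrite sqr_ge0.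
by rewrite norm_sqB norm_sqD; lra.
Qed.

(** Cauchy-Schwarz is read off from the triangle inequality: squaring [|u + v| <= |u| + |v|] leaves
    [dot u v <= |u| * |v|], and [- y] in place of [y] gives the lower bound. *)
Lemma norm_dot_le x y : `|dot x y| <= `|x| * `|y|.
Proof.
have dot_le u v : dot u v <= `|u| * `|v|.
  have := ler_normD u v.
  rewrite -[ `|u + v| <= _](@ler_pXn2r _ 2) ?nnegrE ?addr_ge0//.
  by rewrite norm_sqD sqrrD -mulr_natl; lra.
by rewrite ler_norml dot_le andbT lerNl -dotNr -(normrN y) dot_le.
Qed.

End inner_product.

(** * Borel measurability in separable spaces *)

Section separable_measurability.
Context {R : realType} {V : normedModType R}.
Hypothesis V_separable : separable V.

Lemma separable_dense_seq :
  exists e : nat -> V, forall (x : V) (eps : R), 0 < eps ->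
    exists n, `|x - e n| < eps.
Proof.
have [S /pfcard_geP[S0|[f]] dS] := V_separable.
  (* An empty dense set would miss the whole space, so only an enumerated set remains. *)
  by have [] := dS setT; [exists 0 | exact: openT | move=> x []; rewrite S0].
exists f => x eps eps0.
have [||y [xy /(@surj _ _ _ _ f)[n _ fn]]] := dS (ball x eps).
- by exists x; exact: ballxx.
- exact: ball_open.
- by exists n; rewrite fn; move: xy; rewrite -ball_normE.
Qed.

Context d (X : measurableType d).
Implicit Types f g : X -> V.

(** By separability every open set is a countable union of balls with centres [e n] and radii
    [1 / (m + 1)], so preimages of balls suffice. *)
Lemma borel_measurableP f : (forall c r, measurable [set t | `|f t - c| < r]) ->
  measurable_fun setT (f : X -> borelType V).
Proof.
move=> mf; have [e eP] := separable_dense_seq.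
apply: (@measurability _ _ X (borelType V) setT f (@open V)) => // _ [U oU <-].
rewrite setTI.
pose I := [set n : nat * nat | ball (e n.1) n.2.+1%:R^-1 `<=` U].
have -> : f @^-1` U = \bigcup_n
    (if n \in I then [set t | `|f t - e n.1| < n.2.+1%:R^-1] else set0).
  apply/seteqP; split => [t|t [n _]]; last first.
    by case: ifPn => // /set_mem nU fn; apply: nU; rewrite -ball_normE /= distrC.
  move=> /= Uft; have /nbhs_ballP[r /= r0 rU] := open_nbhs_nbhs (conj oU Uft).
  have [m /[!add0r] mr] := ltr_add_invr (ltac:(by rewrite divr_gt0) : 0 < r / 2).
  have [n fn] := eP (f t) m.+1%:R^-1 ltac:(by []).
  exists (n, m) => //; case: ifPn => [_ //|/negP[]]; apply/mem_set => y.
  rewrite -ball_normE /= => yn.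
  apply: rU; rewrite -ball_normE /=.
  by rewrite (le_lt_trans (ler_distD (e n) _ _))// (splitr r) ltrD// (lt_trans _ mr).
apply: countable_bigcupT_measurable => [|n]; first exact: countableP.
by case: ifP.
Qed.

(** The condition [|f - g| < r] means that for some [n] and [m] both [|f - e n| < r - 1 / (m + 1)]
    and [|g - e n| < 1 / (m + 1)]. This countable union only involves preimages of balls under [f]
    and [g] separately. *)
Lemma measurable_norm_sub f g :
  measurable_fun setT (f : X -> borelType V) ->
  measurable_fun setT (g : X -> borelType V) ->
  measurable_fun setT (fun t => `|f t - g t|).
Proof.
move=> mf mg; have [e eP] := separable_dense_seq.
have mball (h : X -> V) c r : measurable_fun setT (h : X -> borelType V) ->
    measurable [set t | `|h t - c| < r].
  move=> mh; rewrite -[X in measurable X]setTI.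
  apply: (mh _ [set y : V | `|y - c| < r]) => //.
  apply: sub_sigma_algebra.
  rewrite (_ : [set _ | _] = (ball c r : set V)); first exact: ball_open.
  by apply/seteqP; split => y /=; rewrite -ball_normE /= distrC.
apply: (measurability _ (RGenInftyO.measurableE R)) => // _ [_ [r ->] <-].
rewrite setTI.
have -> : (fun t => `|f t - g t|) @^-1` `]-oo, r[ = \bigcup_(n in setT)
    \bigcup_m ([set t | `|f t - e n| < r - m.+1%:R^-1] `&`
      [set t | `|g t - e n| < m.+1%:R^-1]).
  apply/seteqP; split => [t|t [n _ [m _ [/= fn gn]]]]; rewrite /= in_itv /=;
    last by rewrite (le_lt_trans (ler_distD (e n) _ _))// (distrC (e n))
      -(subrK m.+1%:R^-1 r) ltrD.
  rewrite -subr_gt0 => fgr.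
  (* Half of the slack, because [1 / (m + 1)] is spent twice: in moving from [g t] to [e n] and in
     the reduced radius. *)
  pose s := (r - `|f t - g t|) / 2.
  have [m /[!add0r] mr] := ltr_add_invr (ltac:(by rewrite divr_gt0) : 0 < s).
  have [n gn] := eP (g t) m.+1%:R^-1 ltac:(by []).
  exists n => //; exists m => //; split => //=.
  have lin (a b c q : R) : c < (q - a) / 2 -> b < c -> a + b < q - c by lra.
  by rewrite (le_lt_trans (ler_distD (g t) _ _))//; exact: lin mr gn.
apply: bigcupT_measurable => n; apply: bigcupT_measurable => m.
by apply: measurableI; exact: mball.
Qed.

(* A Caratheodory operator is measurable because
   [|G z x - c|] is the infimum of [|G z y - c| + |x - y|] over a dense sequence
   of points [y]. *)
Lemma measurable_caratheodory d' (Z : measurableType d') (G : Z -> V -> V)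
    (z : X -> Z) f :
  (forall s, nonexpansive (G s)) ->
  (forall x, measurable_fun setT (fun s => G s x : borelType V)) ->
  measurable_fun setT z -> measurable_fun setT (f : X -> borelType V) ->
  measurable_fun setT (fun t => G (z t) (f t) : borelType V).
Proof.
move=> Gne mG mz mf; have [e eP] := separable_dense_seq.
apply: borel_measurableP => c r.
have -> : [set t | `|G (z t) (f t) - c| < r] =
    \bigcup_n [set t | `|G (z t) (e n) - c| + `|f t - e n| < r].
  apply/seteqP; split => [t /=|t [n _ /=]].
    rewrite -subr_gt0 => Gr.
    (* Half of the gap, because [|f t - e n|] enters twice: as the second summand and, by
       nonexpansiveness, through [G (z t) (e n)]. *)
    have [n fn] := eP (f t) ((r - `|G (z t) (f t) - c|) / 2)
      ltac:(by rewrite divr_gt0).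
    exists n => //=.
    have := ler_distD (G (z t) (f t)) (G (z t) (e n)) c.
    by have := Gne (z t) (e n) (f t); rewrite (distrC (e n)); lra.
  have := ler_distD (G (z t) (e n)) (G (z t) (f t)) c.
  by have := Gne (z t) (f t) (e n); lra.
apply: bigcupT_measurable => n.
have mh : measurable_fun setT (fun t => `|G (z t) (e n) - c| + `|f t - e n|).
  apply: measurable_funD.
    apply: measurable_norm_sub; last exact: measurable_cst.
    exact: (measurableT_comp (mG (e n))).
  by apply: measurable_norm_sub => //; exact: measurable_cst.
have := mh measurableT `]-oo, r[%classic (measurable_itv _).
by rewrite setTI; congr measurable; apply/seteqP; split => t /=; rewrite in_itv.
Qed.

End separable_measurability.

Lemma continuous_borel_measurable {R : realType} {V W : normedModType R}
    (f : V -> W) :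
  continuous f -> measurable_fun setT (f : borelType V -> borelType W).
Proof.
move=> cf.
apply: (@measurability _ _ (borelType V) (borelType W) setT f (@open W)) => //.
move=> _ [U oU <-].
by rewrite setTI; apply: sub_sigma_algebra; move/continuousP : cf; exact.
Qed.

Lemma continuous_real_measurable {R : realType} {V : normedModType R}
    (f : V -> R^o) :
  continuous f -> measurable_fun setT (f : borelType V -> R).
Proof.
move=> cf; apply: (measurability _ (RGenInftyO.measurableE R)) => // _ [_ [r ->] <-].
rewrite setTI; apply: sub_sigma_algebra; move/continuousP : cf; apply.
exact: open_lt.
Qed.

(** * Bochner integrals tested against vectors *)

Section bochner_dot.
Context {R : realType} {H : completeNormedModType R} (dot : {dot H for idfun}).
Hypothesis dotE : forall x, dot x x = `|x| ^+ 2.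
Hypothesis H_separable : separable H.
Context {d} {X : measurableType d} (mu : probability X R).
Implicit Types (f s : X -> H) (u : H).

Lemma measurable_simple_fun s : simple_fun s ->
  measurable_fun setT (s : X -> borelType H).
Proof.
move=> [fs ms] _ A mA; rewrite setTI.
rewrite (_ : _ @^-1` _ = \bigcup_(v in range s `&` A) (s @^-1` [set v])).
  by apply: fin_bigcup_measurable => //; exact: finite_setIl.
apply/seteqP; split => [x Asx|x [v [_ Av] /= sv]]; last by rewrite /= sv.
by exists (s x) => //; split => //; exists x.
Qed.

Lemma continuous_dot u : continuous (fun x => dot x u : R^o).
Proof.
move=> x; apply/cvgrPdist_le => e e0.
near=> y.
rewrite -[X in `|_ - X|]/(dot y u) -dotNl -dotDl.
rewrite (le_trans (norm_dot_le dotE _ _))//.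
(* The [+ 1] keeps the denominator positive when [u = 0]. *)
rewrite (@le_trans _ _ (e / (`|u| + 1) * `|u|))//.
  rewrite ler_wpM2r//; near: y; apply: cvgr_dist_le => //.
  by rewrite divr_gt0// ltr_wpDl.
rewrite -mulrAC ler_pdivrMr ?ltr_wpDl// ler_pM2l//.
by rewrite lerDl.
Unshelve. all: by end_near. Qed.

Lemma measurable_dot f u : measurable_fun setT (f : X -> borelType H) ->
  measurable_fun setT (fun x => dot (f x) u).
Proof.
exact: (measurableT_comp (continuous_real_measurable (@continuous_dot u))).
Qed.

Lemma dot_simple_funE s u x : simple_fun s ->
  (dot (s x) u)%:E = (\sum_(v <- fset_set (range s))
    (dot v u)%:E * (\1_(s @^-1` [set v]) x)%:E)%E.
Proof.
move=> [fs _].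
rewrite (bigD1_seq (s x)) ?fset_uniq//=; last first.
  by rewrite in_fset_set//; apply/mem_set; exists x.
rewrite indicE mem_set// mule1 big1 ?adde0// => v vsx.
rewrite indicE memNset ?mule0//= => /esym /eqP; exact/negP.
Qed.

Lemma integrable_dot_simple s u : simple_fun s ->
  mu.-integrable setT (EFin \o (fun x => dot (s x) u)).
Proof.
move=> ss.
apply: (@eq_integrable _ _ _ _ _ _ (fun x => \sum_(v <- fset_set (range s))
    (dot v u)%:E * (\1_(s @^-1` [set v]) x)%:E)%E) => //.
  by move=> x _ /=; rewrite dot_simple_funE.
apply: integrable_sum => // v _; apply: integrableZl => //.
by apply: integrable_indic; exact: ss.2.
Qed.

Lemma Rintegral_dot_simple s u : simple_fun s ->
  \int[mu]_x dot (s x) u = dot (simple_integral mu s) u.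
Proof.
move=> ss; rewrite /Rintegral.
under eq_integral do rewrite dot_simple_funE//.
have iv v : mu.-integrable setT (fun x => (\1_(s @^-1` [set v]) x)%:E).
  by apply: integrable_indic; exact: ss.2.
rewrite integral_sum//; last by move=> v; exact: integrableZl.
under eq_bigr => v _.
  rewrite integralZl// integral_indic; [|by []|exact: ss.2].
  rewrite setIT -[X in (_ * X)%E]fineK ?fin_num_measure//; last exact: ss.2.
  rewrite -EFinM; over.
rewrite sumEFin/= /simple_integral fsbig_finite; last exact: ss.1.
rewrite (big_morph (fun v => dot v u) (fun a b => dotDl dot a b u) (id1 := 0)).
  by apply: eq_bigr => v _; rewrite dotZl mulrC.
by rewrite dotC linear0r.
Qed.

Section approximation.
Variable f : X -> H.
Hypothesis mf : measurable_fun setT (f : X -> borelType H).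

Lemma integrable_norm_sub s : simple_fun s ->
  (\int[mu]_x (`|f x - s x|)%:E < +oo)%E ->
  mu.-integrable setT (EFin \o (fun x => `|f x - s x|)).
Proof.
move=> ss foo; apply/integrableP; split.
  apply/measurable_EFinP; apply: measurable_norm_sub => //.
  exact: measurable_simple_fun.
by under eq_integral => x _ do rewrite /= normr_id.
Qed.

Lemma integrable_dot_approx s u : simple_fun s ->
  (\int[mu]_x (`|f x - s x|)%:E < +oo)%E ->
  mu.-integrable setT (EFin \o (fun x => dot (f x) u)).
Proof.
move=> ss foo.
pose g x : R := `|u| * `|f x - s x| + `|dot (s x) u|.
apply: (@le_integrable _ _ _ _ _ measurableT _ (EFin \o g)).
- by apply/measurable_EFinP; exact: measurable_dot.
- move=> x _; rewrite /= lee_fin [leRHS]ger0_norm /g ?addr_ge0 ?mulr_ge0//.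
  have -> : dot (f x) u = dot (f x - s x) u + dot (s x) u by rewrite -dotDl subrK.
  rewrite (le_trans (ler_normD _ _))//.
  by rewrite lerD2r mulrC norm_dot_le.
- have h1 := integrableZl measurableT `|u| (integrable_norm_sub ss foo).
  exact: (integrableD measurableT h1 (integrable_norm (integrable_dot_simple u ss))).
Qed.

(** The error depends on [u] only through [|u|], which is what turns estimates tested against
    vectors into norm estimates. *)
Lemma dot_simple_integral_approx s u e : simple_fun s ->
  (\int[mu]_x (`|f x - s x|)%:E <= e%:E)%E ->
  `|\int[mu]_x dot (f x) u - dot (simple_integral mu s) u| <= e * `|u|.
Proof.
move=> ss fe; have foo := le_lt_trans fe (ltry e).
have ins := integrable_norm_sub ss foo.
have i1 := integrable_dot_approx u ss foo; have i2 := integrable_dot_simple u ss.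
have i12 : mu.-integrable setT (EFin \o (fun x => dot (f x) u - dot (s x) u)).
  exact: (integrableB measurableT i1 i2).
rewrite -Rintegral_dot_simple// -RintegralB// (le_trans (le_normr_Rintegral _ _))//.
apply: (@le_trans _ _ (\int[mu]_x (`|u| * `|f x - s x|))).
  apply: le_Rintegral => //; first exact: integrable_norm.
    exact: (integrableZl measurableT _ ins).
  by move=> x _; rewrite -dotNl -dotDl mulrC norm_dot_le.
rewrite RintegralZl// mulrC ler_wpM2r// -lee_fin /Rintegral fineK//.
exact: integrable_fin_num.
Qed.

Lemma bochner_approx_eventually (s : nat -> X -> H) :
  bochner_approx mu f s -> forall e : R, 0 < e ->
  \forall n \near \oo, (\int[mu]_x (`|f x - s n x|)%:E <= e%:E)%E.
Proof.
move=> [_ /fine_cvgP[ffin /cvgrPdist_le f0]] e e0.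
near=> n.
have ffn : (\int[mu]_x (`|f x - s n x|)%:E)%E \is a fin_num by near: n.
rewrite -(fineK ffn) lee_fin.
rewrite (le_trans (ler_norm _))// -normrN -[X in `|X|]add0r.
by near: n; exact: f0.
Unshelve. all: by end_near. Qed.

(* A vector [w] is controlled by [dot w w], so the weak estimate
   [dot_simple_integral_approx] applied to [u = w] gives strong convergence. *)
Lemma simple_integral_cvg (s : nat -> X -> H) : bochner_approx mu f s ->
  cvgn (fun n => simple_integral mu (s n)).
Proof.
move=> fs; apply/cauchy_cvgP/cauchy_exP => e e0.
have e3 : 0 < e / 3 by rewrite divr_gt0.
have [N _ Ns] := bochner_approx_eventually fs e3.
exists (simple_integral mu (s N)); exists N => // n Nn /=.
rewrite -ball_normE /=; set w := _ - _.
have dw k : (N <= k)%N ->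
    `|\int[mu]_x dot (f x) w - dot (simple_integral mu (s k)) w| <= e / 3 * `|w|.
  by move=> Nk; apply: dot_simple_integral_approx; [exact: fs.1|exact: Ns].
have : `|w| ^+ 2 <= e / 3 * `|w| + e / 3 * `|w|.
  rewrite -dotE {1}/w dotDl dotNl (le_trans (ler_norm _))//.
  rewrite (le_trans (ler_distD (\int[mu]_x dot (f x) w) _ _))//.
  by rewrite lerD ?dw// distrC dw.
have [->//|w0] := eqVneq w 0; first by rewrite normr0.
rewrite -mulrDl expr2 ler_pM2r ?normr_gt0// => we.
by rewrite (le_lt_trans we)//; lra.
Qed.

Lemma bochner_integral_dot (s : nat -> X -> H) u : bochner_approx mu f s ->
  \int[mu]_x dot (f x) u = dot (bochner_integral mu f) u.
Proof.
move=> fs; have /cvg_ex[l sl] := simple_integral_cvg fs.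
(* [xget] selects a limit that comes with its own approximating sequence [t], a priori unrelated to
   [s]; the role of [s] is to show that there is a limit to select. *)
have [t ft tl] : [set v | exists2 t, bochner_approx mu f t &
    simple_integral mu (t n) @[n --> \oo] --> v] (bochner_integral mu f).
  by apply: (xgetPex 0); exists l, s.
apply/eqP; rewrite -subr_eq0 -normr_le0; apply/ler_addgt0Pl => e e0.
rewrite addr0.
have e2 : 0 < e / 2 / (`|u| + 1) by rewrite !divr_gt0// ltr_wpDl.
move/cvgrPdist_le/(_ _ e2) : tl => tl.
have [n [tln ftn]] := filter_ex (filterI tl (bochner_approx_eventually ft e2)).
have ue : e / 2 / (`|u| + 1) * `|u| <= e / 2.
  by rewrite mulrAC ler_pdivrMr ?ltr_wpDl// ler_pM2l ?divr_gt0// lerDl.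
rewrite (splitr e) (le_trans (ler_distD (dot (simple_integral mu (t n)) u) _ _))//.
rewrite lerD//.
  by rewrite (le_trans _ ue)// dot_simple_integral_approx//; exact: ft.1.
rewrite -dotNl -dotDl (le_trans _ ue)// (le_trans (norm_dot_le dotE _ _))//.
by rewrite ler_wpM2r// distrC.
Qed.

End approximation.

(** The interface to the Bochner integral: the mean operator is used below only through these two
    facts. *)
Lemma bochner_integrable_dot f u :
  measurable_fun setT (f : X -> borelType H) -> bochner_integrable mu f ->
  mu.-integrable setT (EFin \o (fun x => dot (f x) u)) /\
  \int[mu]_x dot (f x) u = dot (bochner_integral mu f) u.
Proof.
move=> mf [_ [s fs]]; split; last exact: (bochner_integral_dot mf u fs).
have [n fsn] := filter_ex (bochner_approx_eventually fs ltr01).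
by apply: (@integrable_dot_approx _ mf (s n)); [exact: fs.1|
  exact: le_lt_trans fsn (ltry _)].
Qed.

End bochner_dot.

(** * The mean operator and the one-step inequality *)

Section has_Rintegral.
Context {R : realType} {d} {X : measurableType d} (mu : probability X R).
Implicit Types (f g : X -> R) (a b c : R).

(** Integrability is bundled with the value so that each linear rule below propagates both at
    once. *)
Definition has_Rintegral f a :=
  mu.-integrable setT (EFin \o f) /\ \int[mu]_x f x = a.

Lemma has_Rintegral_cst c : has_Rintegral (cst c) c.
Proof.
split; first exact: finite_measure_integrable_cst.
by rewrite Rintegral_cst// [X in fine X]probability_setT mulr1.
Qed.

Lemma has_RintegralD f g a b : has_Rintegral f a -> has_Rintegral g b ->
  has_Rintegral (fun x => f x + g x) (a + b).
Proof.
move=> [mf <-] [mg <-]; split; last by rewrite RintegralD.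
exact: (integrableD measurableT mf mg).
Qed.

Lemma has_RintegralZ c f a : has_Rintegral f a ->
  has_Rintegral (fun x => c * f x) (c * a).
Proof.
move=> [mf <-]; split; last by rewrite RintegralZl.
exact: (integrableZl measurableT _ mf).
Qed.

Lemma has_RintegralB f g a b : has_Rintegral f a -> has_Rintegral g b ->
  has_Rintegral (fun x => f x - g x) (a - b).
Proof.
move=> [mf <-] [mg <-]; split; last by rewrite RintegralB.
exact: (integrableB measurableT mf mg).
Qed.

Lemma has_Rintegral_le f g a b : has_Rintegral f a -> has_Rintegral g b ->
  (forall x, f x <= g x) -> a <= b.
Proof. by move=> [mf <-] [mg <-] fg; exact: le_Rintegral. Qed.

Lemma has_RintegralE f a : has_Rintegral f a -> (\int[mu]_x (f x)%:E = a%:E)%E.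
Proof. by move=> [mf <-]; rewrite /Rintegral fineK//; exact: integrable_fin_num. Qed.

End has_Rintegral.

Lemma measurable_affine {R : realType} {V : normedModType R} {d}
    {X : measurableType d} (a : V) (t : R) (f : X -> V) :
  measurable_fun setT (f : X -> borelType V) ->
  measurable_fun setT (fun x => a + t *: f x : borelType V).
Proof.
apply: (measurableT_comp (continuous_borel_measurable (f := fun y => a + t *: y) _)).
by move=> y; apply: cvgD; [exact: cvg_cst|exact: cvgZr].
Qed.

Section mean_operator.
Context {R : realType} {H : completeNormedModType R} (dot : {dot H for idfun}).
Hypothesis dotE : forall x, dot x x = `|x| ^+ 2.
Hypothesis H_separable : separable H.
Context {d} {Xi : measurableType d} (D : probability Xi R).
Variables (T : Xi -> H -> H) (M : H -> H).
Hypothesis T_nonexpansive : forall z, nonexpansive (T z).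
Hypothesis T_measurable : forall x,
  measurable_fun setT (fun z => T z x : borelType H).
Hypothesis T_mean : forall x u,
  has_Rintegral D (fun z => dot (T z x) u) (dot (M x) u).

(** Testing against [w = M x - M y] itself gives [|w| ^ 2], the mean of [dot (T z x - T z y) w],
    which Cauchy-Schwarz bounds by [|x - y| * |w|]. *)
Lemma mean_nonexpansive : nonexpansive M.
Proof.
move=> x y; set w := _ - _.
have : `|w| ^+ 2 <= `|x - y| * `|w|.
  rewrite -dotE {1}/w dotDl dotNl.
  apply: (has_Rintegral_le (has_RintegralB (T_mean x w) (T_mean y w))
    (has_Rintegral_cst D _)) => z /=.
  rewrite -dotNl -dotDl (le_trans (ler_norm _))//.
  by rewrite (le_trans (norm_dot_le dotE _ _))// ler_wpM2r// T_nonexpansive.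
have [->|w0] := eqVneq w 0; first by rewrite normr0.
by rewrite expr2 ler_pM2r ?normr_gt0.
Qed.

Lemma measurable_noise p : measurable_fun setT (fun z => `|T z p - p| ^+ 2).
Proof.
apply: measurable_funX; apply: measurable_norm_sub => //.
Qed.

(* Nonexpansiveness gives [dot (T z p - T z q) (p - q) <= |p - q| ^ 2], with
   equality in the mean. *)
Lemma ae_eq_noise p q : M p = p -> M q = q ->
  {ae D, forall z, T z p - p = T z q - q}.
Proof.
move=> Mp Mq.
(* The slack in the inequality above. It dominates half of the squared difference of the noises, and
   its mean is [|p - q| ^ 2 - dot (p - q) (p - q) = 0]. *)
pose f z := `|p - q| ^+ 2 - (dot (T z p) (p - q) - dot (T z q) (p - q)).
have f_ge z : `|(T z p - T z q) - (p - q)| ^+ 2 <= 2 * f z.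
  rewrite (norm_sqB dotE) /f -dotNl -dotDl.
  have : `|T z p - T z q| ^+ 2 <= `|p - q| ^+ 2.
    by rewrite ler_pXn2r ?nnegrE// T_nonexpansive.
  by lra.
have f_ge0 z : 0 <= f z.
  by have := f_ge z; have := sqr_ge0 `|T z p - T z q - (p - q)|; lra.
have [intf f0] : has_Rintegral D f 0.
  have := has_RintegralB (has_Rintegral_cst D (`|p - q| ^+ 2))
    (has_RintegralB (T_mean p (p - q)) (T_mean q (p - q))).
  by rewrite Mp Mq -dotNl -dotDl dotE subrr.
have intf0 : (\int[D]_z `|(f z)%:E| = 0)%E.
  under eq_integral do rewrite gee0_abs ?lee_fin//.
  exact: (has_RintegralE (conj intf f0)).
have := (ae_eq_integral_abs D measurableT (measurable_int _ intf)).1 intf0.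
apply: filterS => z /(_ I) [fz].
have := f_ge z; rewrite fz mulr0 => n0.
have : `|T z p - T z q - (p - q)| ^+ 2 == 0 by rewrite eq_le n0 sqr_ge0.
rewrite sqrf_eq0 normr_eq0 subr_eq0 => /eqP Tpq.
have -> : T z p = p - q + T z q by rewrite -Tpq subrK.
by rewrite addrAC (addrC p) addrK addrC.
Qed.

Lemma variance_fixed_point p q : M p = p -> M q = q ->
  (\int[D]_z (`|T z p - p| ^+ 2)%:E = \int[D]_z (`|T z q - q| ^+ 2)%:E)%E.
Proof.
move=> Mp Mq; apply: ae_eq_integral => //.
- by apply/measurable_EFinP; exact: measurable_noise.
- by apply/measurable_EFinP; exact: measurable_noise.
by apply: filterS (ae_eq_noise Mp Mq) => z -> _.
Qed.

Variables (p : H) (sigma : R).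
Hypothesis Mp : M p = p.
Hypothesis variance_le : (\int[D]_z (`|T z p - p| ^+ 2)%:E <= (sigma ^+ 2)%:E)%E.

(** The integrand is dominated pointwise by a function [g] that is affine in inner products with
    [T z x] and [T z p] and in [|T z p - p| ^ 2], so that its mean is computed from [T_mean]
    alone. *)
Lemma km_step_expectation_le (t : R) x : 0 < t < 1 ->
  (\int[D]_z (`|(1 - t) *: x + t *: T z x - p| ^+ 2)%:E <=
   ((1 + 2 * t ^+ 2) * `|x - p| ^+ 2 + 2 * t ^+ 2 * sigma ^+ 2
    - t * (1 - t) * `|M x - x| ^+ 2)%:E)%E.
Proof.
move=> /andP[t0 t1].
have [v intv vs] : exists2 v, has_Rintegral D (fun z => `|T z p - p| ^+ 2) v &
    v <= sigma ^+ 2.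
  have intn : D.-integrable setT (EFin \o (fun z => `|T z p - p| ^+ 2)).
    apply/integrableP; split.
      by apply/measurable_EFinP; exact: measurable_noise.
    under eq_integral do rewrite gee0_abs ?lee_fin ?sqr_ge0//.
    exact: le_lt_trans variance_le (ltry _).
  exists (\int[D]_z `|T z p - p| ^+ 2) => //.
  by rewrite -lee_fin -(has_RintegralE (conj intn erefl)).
(* [U] is the noiseless step seen from [p]; the actual step adds [t *: (T z x - M x)] to it. *)
pose U := (1 - t) *: (x - p) + t *: (M x - p).
pose m := M x - M p.
pose B := `|U| ^+ 2 - 2 * t * dot (M x) U + 2 * t ^+ 2 * (`|x - p| ^+ 2 + `|m| ^+ 2).
pose g z := B + 2 * t * dot (T z x) U
  - 4 * t ^+ 2 * (dot (T z x) m - dot (T z p) m) + 2 * t ^+ 2 * `|T z p - p| ^+ 2.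
have intg : has_Rintegral D g
    (B + 2 * t * dot (M x) U - 4 * t ^+ 2 * (dot (M x) m - dot (M p) m)
     + 2 * t ^+ 2 * v).
  apply: has_RintegralD; last exact: has_RintegralZ.
  apply: has_RintegralB; last by apply: has_RintegralZ; exact: has_RintegralB.
  apply: has_RintegralD; first exact: has_Rintegral_cst.
  exact: has_RintegralZ.
have le_g z : `|(1 - t) *: x + t *: T z x - p| ^+ 2 <= g z.
  have -> : (1 - t) *: x + t *: T z x - p = U + t *: (T z x - M x).
    rewrite /U -[RHS]addrA -scalerDr [M x - p + _]addrC subrKA !scalerBr addrACA.
    by rewrite -opprD -scalerDl subrK scale1r.
  rewrite (norm_sqD dotE) normrZ exprMn dotZr (gtr0_norm t0).
  have : `|T z x - M x| ^+ 2 <= 2 * (`|x - p| ^+ 2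
      - 2 * (dot (T z x) m - dot (T z p) m) + `|m| ^+ 2) + 2 * `|T z p - p| ^+ 2.
    (* The noise at [x] is the noise at [p] plus the centred increment from [p] to [x]. Expanding
       the square of the increment, rather than bounding it by norms, keeps the constant of
       [|x - p| ^ 2] at 2. *)
    have -> : T z x - M x = (T z x - T z p - m) + (T z p - p).
      by rewrite /m Mp [RHS]addrAC subrKA opprB subrKA.
    rewrite (le_trans (norm_sqD_le dotE _ _))// (norm_sqB dotE) -dotNl -dotDl.
    have : `|T z x - T z p| ^+ 2 <= `|x - p| ^+ 2.
      by rewrite ler_pXn2r ?nnegrE// T_nonexpansive.
    by lra.
  rewrite -(@ler_pM2l _ (t ^+ 2)) ?exprn_gt0// dotC dotDl dotNl /g /B.
  by lra.
apply: (@le_trans _ _ (\int[D]_z (g z)%:E)%E).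
  apply: ge0_le_integral => //.
  - apply/measurable_EFinP/measurable_funX/measurable_norm_sub => //.
    exact: measurable_affine.
  - exact: measurable_int intg.1.
  - by move=> z _; rewrite lee_fin.
rewrite (has_RintegralE intg) lee_fin.
(* The convexity identity for [U] releases [- t (1 - t) |M x - x| ^ 2]; the leftover
   [- 2 t ^ 2 |m| ^ 2] in the mean of [g] is discarded. *)
have := norm_sq_convex dotE t (x - p) (M x - p).
rewrite -/U opprB addrA subrK (distrC x (M x)).
have : dot (M x) m - dot (M p) m = `|m| ^+ 2 by rewrite -dotE -dotNl -dotDl.
have : t * `|M x - p| ^+ 2 <= t * `|x - p| ^+ 2.
  by rewrite ler_pM2l// ler_pXn2r ?nnegrE// -{1}Mp mean_nonexpansive.
have : t ^+ 2 * v <= t ^+ 2 * sigma ^+ 2 by rewrite ler_pM2l// exprn_gt0.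
have : 0 <= t ^+ 2 * `|m| ^+ 2 by rewrite mulr_ge0 ?sqr_ge0.
by rewrite /B => m0 tv tm -> Um; lra.
Qed.

End mean_operator.

(** * Independence *)

Section lower_integral.
Import HBNNSimple.

(* [f] need not be measurable: its integral is then a lower integral. *)
Lemma ae_le_integral_lower {R : realType} {d} {X : measurableType d}
    (mu : {measure set X -> \bar R}) (f g : X -> \bar R) :
  (forall x, 0 <= f x)%E -> (forall x, 0 <= g x)%E -> measurable_fun setT g ->
  {ae mu, forall x, f x <= g x}%E -> (\int[mu]_x f x <= \int[mu]_x g x)%E.
Proof.
(* The integral of a nonnegative [f] is a supremum over simple [h <= f], and each such [h] is below
   [g] almost everywhere. *)
move=> f0 g0 mg fg; rewrite (ge0_integralTE _ f0).
apply: ge_ereal_sup => _ [h /= hf <-].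
rewrite -integralT_nnsfun; apply: ae_ge0_le_integral => //.
- by move=> x _; rewrite lee_fin.
- exact/measurable_EFinP.
- by apply: filterS fg => x fgx _; exact: le_trans (hf x) fgx.
Qed.

End lower_integral.

(** Independence on rectangles identifies the joint law with the product law; Tonelli then
    integrates [Z] out with [X] frozen, in place of a conditional expectation. *)
Lemma integral_independent_pair {R : realType} {d} {Omega : measurableType d}
    (P : probability Omega R) {dU} {U : measurableType dU} {dW}
    {W : measurableType dW} (X : Omega -> U) (Z : {RV P >-> W})
    (f : U * W -> \bar R) :
  measurable_fun setT X ->
  (forall A B, measurable A -> measurable B ->
    P (X @^-1` A `&` Z @^-1` B) = (P (X @^-1` A) * P (Z @^-1` B))%E) ->
  measurable_fun setT f -> (forall u, 0 <= f u)%E ->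
  (\int[P]_w f (X w, Z w) = \int[P]_w \int[distribution P Z]_z f (X w, z))%E.
Proof.
move=> mX indep mf f0.
pose X' : {mfun Omega >-> U} := HB.pack X (isMeasurableFun.Build _ _ _ _ X mX).
have mXZ : measurable_fun setT (fun w => (X w, Z w)) by exact: measurable_fun_pair.
pose XZ : {mfun Omega >-> (U * W)%type} :=
  HB.pack (fun w => (X w, Z w)) (isMeasurableFun.Build _ _ _ _ _ mXZ).
rewrite -(ge0_integral_distribution (P := P) (XZ : {RV P >-> _}) mf f0).
rewrite (eq_measure_integral (distribution P X' \x distribution P Z)%E); last first.
  move=> A mA _; apply/esym/(product_measure_unique (m' := distribution P XZ)) => //.
rewrite fubini_tonelli1//.
rewrite (ge0_integral_distribution (P := P) (X' : {RV P >-> _}))//.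
  exact: measurable_fun_fubini_tonelli_F.
by move=> u; exact: integral_ge0.
Qed.

Section past.
Context {R : realType} {d} {Omega : measurableType d} (P : probability Omega R).
Context {dXi} {Xi : measurableType dXi} (xi : nat -> {RV P >-> Xi}).
Hypothesis xi_independent : mutually_independent xi.

(** Finite-dimensional cylinders generate the sigma-algebra of the first [k] draws and, unlike the
    union of the individual preimages, are in general stable under intersection. *)
Definition past_cylinders k : set (set Omega) :=
  [set C | exists2 A : nat -> set Xi, (forall j, measurable (A j)) &
    C = \bigcap_(j in [set` iota 0 k]) (xi j @^-1` A j)].

Lemma measurable_past_cylinders k : past_cylinders k `<=` measurable.
Proof.
move=> _ [A mA ->]; apply: bigcap_measurableType => j _.
exact: measurable_funPTI.
Qed.

Lemma past_cylindersI k : setI_closed (past_cylinders k).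
Proof.
move=> _ _ [A mA ->] [B mB ->]; exists (fun j => A j `&` B j).
  by move=> j; exact: measurableI.
by rewrite -bigcapI.
Qed.

(** Both sides are finite measures in [C] that agree on the cylinders, a pi-system, hence on the
    sigma-algebra it generates. *)
Lemma past_independent k C A : <<s past_cylinders k >> C -> measurable A ->
  P (C `&` xi k @^-1` A) = (P C * P (xi k @^-1` A))%E.
Proof.
move=> sC mA.
have mF : measurable (xi k @^-1` A) by exact: measurable_funPTI.
have PF0 : 0 <= fine (P (xi k @^-1` A)) by exact: fine_ge0.
have mscaleE B : mscale (NngNum PF0) P B = (P B * P (xi k @^-1` A))%E.
  by rewrite /mscale /= fineK ?fin_num_measure// muleC.
rewrite -mscaleE.
apply: (@g_sigma_algebra_measure_unique _ R Omega (past_cylinders k) _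
  (fun=> setT) _ _ (mrestr P mF) (mscale (NngNum PF0) P)) => //.
- exact: measurable_past_cylinders.
- move=> _; exists (fun=> setT) => //.
  by apply/seteqP; split => // w _ j _.
- by apply/seteqP; split => // w _; exists 0%N.
- exact: past_cylindersI.
- move=> _ [B mB ->].
  apply: etrans; last exact/esym/mscaleE; rewrite /= /mrestr.
  (* The cylinder [B] extended by [A] at index [k], so that mutual independence of the first [k + 1]
     draws applies. *)
  pose B' j := if (j < k)%N then B j else A.
  have mB' j : measurable (B' j) by rewrite /B'; case: ifP.
  have := @xi_independent (rcons (iota 0 k) k) B'.
  have kk : k \notin iota 0 k by rewrite mem_iota ltnn andbF.
  rewrite rcons_uniq kk iota_uniq => /(_ isT mB').
  rewrite big_rcons/= -(@xi_independent _ _ (iota_uniq 0 k) mB').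
  have -> : B' k = A by rewrite /B' ltnn.
  have -> : \bigcap_(j in [set` iota 0 k]) (xi j @^-1` B' j) =
      \bigcap_(j in [set` iota 0 k]) (xi j @^-1` B j).
    by apply: eq_bigcapr => j /=; rewrite mem_iota /= add0n /B' => ->.
  have -> // : \bigcap_(j in [set` rcons (iota 0 k) k]) (xi j @^-1` B' j) =
      \bigcap_(j in [set` iota 0 k]) (xi j @^-1` B j) `&` xi k @^-1` A.
  apply/seteqP; split => w.
    move=> wB; split => [j /=|]; last first.
      by have := wB k; rewrite /= mem_rcons mem_head /B' ltnn; apply.
    move=> jk; have := wB j; rewrite /= mem_rcons in_cons jk orbT => /(_ isT).
    by move: jk; rewrite mem_iota /= add0n /B' => ->.
  move=> [wB wA] j /=; rewrite mem_rcons in_cons => /predU1P[->|jk].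
    by rewrite /B' ltnn.
  by have := wB _ jk; move: jk; rewrite /= mem_iota /= add0n /B' => ->.
- by move=> n; rewrite /= /mrestr (le_lt_trans (probability_le1 _ _)) ?ltry// setTI.
Qed.

Lemma measurable_past k j : (j < k)%N ->
  measurable_fun setT (xi j : g_sigma_algebraType (past_cylinders k) -> Xi).
Proof.
move=> jk _ A mA; rewrite setTI; apply: sub_sigma_algebra.
exists (fun i => if i == j then A else setT) => [i|]; first by case: ifP.
apply/seteqP; split => w /=.
  by move=> wA i _ /=; case: eqP => // ->.
by move=> /(_ j); rewrite /= eqxx; apply; rewrite mem_iota.
Qed.

Lemma measurable_sigma_of_sequence j : measurable_fun setT
  (xi j : g_sigma_algebraType (\bigcup_k g_sigma_algebra_preimage (xi k)) -> Xi).
Proof.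
move=> _ A mA; rewrite setTI; apply: sub_sigma_algebra.
by exists j => //; exists A => //; rewrite setTI.
Qed.

End past.

(** * Measurability of the iterates *)

Section km_measurability.
Context {R : realType} {V : normedModType R}.
Hypothesis V_separable : separable V.
Context {dXi} {Xi : measurableType dXi} (T : Xi -> V -> V).
Hypothesis T_nonexpansive : forall z, nonexpansive (T z).
Hypothesis T_measurable : forall x,
  measurable_fun setT (fun z => T z x : borelType V).
Variables (lambda : nat -> R) (x0 : V).
Hypothesis lambda01 : forall k, 0 < lambda k < 1.

Lemma nonexpansive_km_step k z :
  nonexpansive (fun x => (1 - lambda k) *: x + lambda k *: T z x).
Proof.
move=> x y; have /andP[l0 l1] := lambda01 k.
rewrite opprD addrACA -!scalerBr (le_trans (ler_normD _ _))//.
rewrite !normrZ !gtr0_norm ?subr_gt0//.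
have : lambda k * `|T z x - T z y| <= lambda k * `|x - y|.
  by rewrite ler_pM2l//; exact: T_nonexpansive.
by lra.
Qed.

Lemma measurable_km_step {d} {X : measurableType d} k (z : X -> Xi) (f : X -> V) :
  measurable_fun setT z -> measurable_fun setT (f : X -> borelType V) ->
  measurable_fun setT
    (fun t => (1 - lambda k) *: f t + lambda k *: T (z t) (f t) : borelType V).
Proof.
move=> mz mf.
apply: (measurable_caratheodory V_separable (@nonexpansive_km_step k)) => //.
by move=> x; exact: measurable_affine.
Qed.

(** The sigma-algebra on the source is arbitrary: the ambient one gives random variables, the one of
    the past cylinders gives independence from the next draw, and the one of the whole sequence
    gives independence from the random index. *)
Lemma measurable_km_iter {d} {X : measurableType d} k (z : nat -> X -> Xi) :
  (forall j, (j < k)%N -> measurable_fun setT (z j)) ->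
  measurable_fun setT (fun w => km_iter T lambda x0 (z^~ w) k : borelType V).
Proof.
elim: k => [|k IH] mz; first exact: measurable_cst.
by apply: measurable_km_step; [exact: mz|apply: IH => j jk; exact/mz/ltnW].
Qed.

End km_measurability.

(** * Real sequences *)

Section real_sequences.
Context {R : realType}.
Implicit Types (lambda a c r w : nat -> R).

Lemma growth_factor_gt0 (t : R) : 0 < 1 + 2 * t ^+ 2.
Proof. by rewrite ltr_wpDr// mulr_ge0// sqr_ge0. Qed.

Lemma LambdaS lambda k :
  Lambda lambda k.+1 * (1 + 2 * lambda k ^+ 2) = Lambda lambda k.
Proof. by rewrite /Lambda big_ord_recr/= mulfVK// gt_eqF// growth_factor_gt0. Qed.

Lemma Lambda_gt0 lambda k : 0 < Lambda lambda k.
Proof. by apply: prodr_gt0 => i _; rewrite invr_gt0 growth_factor_gt0. Qed.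

Lemma Lambda_nonincreasing lambda :
  {homo Lambda lambda : m n / (m <= n)%N >-> n <= m}.
Proof.
apply: homo_leq => [x|x y z xy yz|k] //; first exact: le_trans yz xy.
rewrite -[leRHS]LambdaS ler_peMr//; first by rewrite ltW ?Lambda_gt0.
by rewrite lerDl mulr_ge0// sqr_ge0.
Qed.

Lemma Lambda_le1 lambda k : Lambda lambda k <= 1.
Proof.
by have := Lambda_nonincreasing lambda (leq0n k); rewrite {2}/Lambda big_ord0.
Qed.

(** Each factor is at least [expR (- (2 * lambda k ^ 2))] by [1 + x <= expR x]. Summable squares
    thus bound [Lambda] below uniformly in [k]. *)
Lemma Lambda_ge_expR lambda k (s : R) : \sum_(i < k) lambda i ^+ 2 <= s ->
  expR (- (2 * s)) <= Lambda lambda k.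
Proof.
move=> ls; rewrite (@le_trans _ _ (expR (- (2 * \sum_(i < k) lambda i ^+ 2))))//.
  by rewrite ler_expR lerN2 ler_pM2l.
elim: k {ls} => [|k IH].
  by rewrite big_ord0 mulr0 oppr0 expR0 /Lambda big_ord0.
rewrite big_ord_recr/= mulrDr opprD expRD -LambdaS in IH *.
rewrite -(@ler_pM2r _ (1 + 2 * lambda k ^+ 2)) ?growth_factor_gt0//.
apply: le_trans IH; rewrite -mulrA ler_piMr ?expR_ge0//.
rewrite expRN mulrC ler_pdivrMr ?expR_gt0// mul1r.
exact: expR_ge1Dx.
Qed.

(** Multiplying by [Lambda lambda k.+1] turns the growth factor into [Lambda lambda k], so the sum
    telescopes; the discount in front of [c k] is bounded by 1. The induction carries
    [Lambda lambda K * a K], dropped at the end. *)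
Lemma discounted_sum_le lambda a b c :
  (forall k, 0 <= a k) -> (forall k, 0 <= c k) ->
  (forall k, a k.+1 + b k <= (1 + 2 * lambda k ^+ 2) * a k + c k) ->
  forall K, \sum_(k < K) Lambda lambda k.+1 * b k <= a 0%N + \sum_(k < K) c k.
Proof.
move=> a0 c0 abc K.
suff : Lambda lambda K * a K + \sum_(k < K) Lambda lambda k.+1 * b k <=
    a 0%N + \sum_(k < K) c k.
  by apply: le_trans; rewrite lerDr mulr_ge0// ltW// Lambda_gt0.
elim: K => [|K IH].
  by rewrite !big_ord0 /Lambda big_ord0 mul1r.
rewrite !big_ord_recr/= addrA.
have : Lambda lambda K.+1 * (a K.+1 + b K) <= Lambda lambda K * a K + c K.
  rewrite (le_trans (ler_wpM2l (ltW (Lambda_gt0 lambda K.+1)) (abc K)))//.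
  rewrite mulrDr mulrA LambdaS lerD2l ler_piMl//.
  exact: Lambda_le1.
by rewrite mulrDr; lra.
Qed.

Lemma running_min_le r K k : (k < K)%N -> running_min r K <= r k.
Proof.
by move=> kK; rewrite /running_min -[r k]/(r (Ordinal kK)); exact: bigmin_le.
Qed.

Lemma running_min_ge0 r K : (forall k, 0 <= r k) -> 0 <= running_min r K.
Proof. by move=> r0; apply/bigmin_geP; split. Qed.

(** On the indices from [m] to [K] the squared minimum times the weight is at most a tail of a
    convergent series, and the weight before [m] is eventually negligible. *)
Lemma running_min_littleo w r B : (forall k, 0 <= w k) -> (forall k, 0 <= r k) ->
  (forall K, \sum_(k < K) w k * r k ^+ 2 <= B) ->
  (fun K => \sum_(k < K) w k) @ \oo --> +oo ->
  (fun K => running_min r K : R^o) =o_\oo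
    (fun K => (Num.sqrt (\sum_(k < K) w k))^-1 : R^o).
Proof.
move=> w0 r0 wrB Soo; apply/eqoP => e e0.
pose u K := \sum_(k < K) w k * r k ^+ 2.
have u_nd : nondecreasing_seq u.
  apply/nondecreasing_seqP => k; rewrite /u big_ord_recr/= lerDl.
  by rewrite mulr_ge0// sqr_ge0.
have u_ub : has_ubound (range u) by exists B => _ [K _ <-]; exact: wrB.
(* The factor 1/2 pays for the bound [S K - S m >= S K / 2], valid once [S K >= 2 * S m]. *)
have [m um] : exists m, forall K, u K <= u m + e ^+ 2 / 2.
  have := nondecreasing_cvgn u_nd u_ub.
  move=> /cvgrPdist_le /(_ (e ^+ 2 / 2)) [].
    by rewrite divr_gt0// exprn_gt0.
  move=> m _ /(_ m (leqnn m)) /= /(le_trans (ler_norm _)) um.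
  exists m => K; rewrite addrC -lerBlDr; apply: le_trans um.
  by rewrite lerD2r; apply: ub_le_sup => //; exists K.
pose S K := \sum_(k < K) w k.
near=> K.
have mK : (m <= K)%N by near: K; exact: nbhs_infty_ge.
have SK1 : 1 <= S K by near: K; move/cvgryPge : Soo; exact.
have SKm : 2 * S m <= S K by near: K; move/cvgryPge : Soo; exact.
have rm0 := running_min_ge0 K r0.
set q := running_min r K in rm0 *.
have SE (f : nat -> R) : \sum_(k < K) f k = \sum_(k < m) f k + \sum_(m <= k < K) f k.
  by rewrite -!(big_mkord xpredT) -big_cat_nat.
have qS : q ^+ 2 * (S K - S m) <= u K - u m.
  rewrite /S /u (SE w) (SE (fun k => w k * r k ^+ 2)).
  rewrite !(addrC (\sum_(k < m) _)) !addrK big_distrr/=.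
  apply: ler_sum_nat => k /andP[_ kK]; rewrite mulrC ler_wpM2l//.
  by rewrite ler_pXn2r ?nnegrE// running_min_le.
have {}qS : q ^+ 2 * S K <= e ^+ 2.
  have := um K; have : 0 <= q ^+ 2 * (S K - 2 * S m).
    by rewrite mulr_ge0 ?sqr_ge0 ?subr_ge0.
  by lra.
rewrite ger0_norm// ger0_norm ?invr_ge0 ?sqrtr_ge0//.
rewrite ler_pdivlMr ?sqrtr_gt0 ?(lt_le_trans ltr01)//.
rewrite -(@ler_pXn2r _ 2) ?nnegrE ?mulr_ge0 ?sqrtr_ge0 ?(ltW e0)//.
by rewrite exprMn sqr_sqrtr//; exact: le_trans ler01 SK1.
Unshelve. all: by end_near. Qed.

End real_sequences.

(** * The recurrence for the random iterates *)

Section km_process.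
Context {R : realType} {H : completeNormedModType R} (dot : {dot H for idfun}).
Hypothesis dotE : forall x, dot x x = `|x| ^+ 2.
Hypothesis H_separable : separable H.
Context {d} {Xi : measurableType d} (D : probability Xi R).
Variables (T : Xi -> H -> H) (M : H -> H).
Hypothesis T_nonexpansive : forall z, nonexpansive (T z).
Hypothesis T_measurable : forall x,
  measurable_fun setT (fun z => T z x : borelType H).
Hypothesis T_mean : forall x u,
  has_Rintegral D (fun z => dot (T z x) u) (dot (M x) u).
Variables (lambda : nat -> R) (x0 : H).
Hypothesis lambda01 : forall k, 0 < lambda k < 1.
Context {dO} {Omega : measurableType dO} (P : probability Omega R).
Variable xi : nat -> {RV P >-> Xi}.
Hypothesis xi_law : forall k (A : set Xi), measurable A ->
  distribution P (xi k) A = D A.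
Hypothesis xi_independent : mutually_independent xi.

Let x k w := km_iter T lambda x0 (fun i => xi i w) k.
Let w k := lambda k * (1 - lambda k).

Let measurable_x k : measurable_fun setT (x k : Omega -> borelType H).
Proof. exact: (measurable_km_iter H_separable). Qed.

(** The iterate [x k] is a function of the draws before [k] only. *)
Lemma km_iter_independent k (A : set (borelType H)) (B : set Xi) :
  measurable A -> measurable B ->
  P (x k @^-1` A `&` xi k @^-1` B) = (P (x k @^-1` A) * P (xi k @^-1` B))%E.
Proof.
move=> mA mB; apply: (past_independent xi_independent) => //.
have := @measurable_km_iter _ _ H_separable _ _ _ T_nonexpansive T_measurable
  _ x0 lambda01 _ (g_sigma_algebraType (past_cylinders xi k)) k xi
  (@measurable_past _ _ _ _ _ _ xi k).
by move=> /(_ measurableT A mA); rewrite setTI.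
Qed.

Lemma measurable_residual {d'} {X : measurableType d'} (f : X -> H) :
  measurable_fun setT (f : X -> borelType H) ->
  measurable_fun setT (fun t => `|M (f t) - f t|).
Proof.
move=> mf; apply: measurable_norm_sub => //.
(* [M] is a Caratheodory family that is constant in its parameter. *)
apply: (measurable_caratheodory H_separable (G := fun _ : X => M) (z := id)) => //.
by move=> _; exact: (mean_nonexpansive dotE T_nonexpansive T_mean).
Qed.

Section fixed_point.
Variables (p : H) (sigma : R).
Hypothesis Mp : M p = p.
Hypothesis variance_le : (\int[D]_z (`|T z p - p| ^+ 2)%:E <= (sigma ^+ 2)%:E)%E.

(** The moments are extended reals because their finiteness is itself deduced from the recurrence,
    by induction from the deterministic [x0]. For the same reason the residual stands on the left,
    so that nothing possibly infinite is subtracted. *)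
Let a k := (\int[P]_t (`|x k t - p| ^+ 2)%:E)%E.
Let rho k := (\int[P]_t (`|M (x k t) - x k t| ^+ 2)%:E)%E.

Lemma km_recurrence k : (a k.+1 + (w k)%:E * rho k <=
  (1 + 2 * lambda k ^+ 2)%:E * a k + (2 * lambda k ^+ 2 * sigma ^+ 2)%:E)%E.
Proof.
have /andP[l0 l1] := lambda01 k.
pose phi (u : borelType H * Xi) : \bar R :=
  (`|(1 - lambda k) *: u.1 + lambda k *: T u.2 u.1 - p| ^+ 2)%:E.
have mphi : measurable_fun setT phi.
  apply/measurable_EFinP/measurable_funX/measurable_norm_sub => //.
  exact: (measurable_km_step H_separable).
have phi0 u : (0 <= phi u)%E by rewrite lee_fin sqr_ge0.
(* The draw [xi k] is independent of [x k], so it is integrated out first with the iterate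
   frozen. *)
have -> : a k.+1 = (\int[P]_t \int[D]_z phi (x k t, z))%E.
  rewrite /a -[LHS]/(\int[P]_t phi (x k t, xi k t))%E.
  rewrite (integral_independent_pair (measurable_x k) (@km_iter_independent k)
    mphi phi0).
  apply: eq_integral => t _; apply: eq_measure_integral => A mA _.
  exact: xi_law.
pose r t := `|M (x k t) - x k t| ^+ 2.
pose b t := (1 + 2 * lambda k ^+ 2) * `|x k t - p| ^+ 2
  + 2 * lambda k ^+ 2 * sigma ^+ 2 - w k * r t.
have w0 : 0 <= w k by rewrite mulr_ge0// ?subr_ge0 ltW.
have g0 := growth_factor_gt0 (lambda k).
have phib t : (\int[D]_z phi (x k t, z) <= (b t)%:E)%E.
  exact: (km_step_expectation_le dotE H_separable T_nonexpansive T_measurable T_mean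
    Mp variance_le (x k t) (lambda01 k)).
have b0 t : (0 <= (b t)%:E)%E.
  by apply: le_trans (phib t); exact: integral_ge0.
have mr : measurable_fun setT (fun t => (r t)%:E).
  by apply/measurable_EFinP/measurable_funX; exact: measurable_residual.
have mx : measurable_fun setT (fun t => (`|x k t - p| ^+ 2)%:E).
  by apply/measurable_EFinP/measurable_funX/measurable_norm_sub.
have mb : measurable_fun setT (fun t => (b t)%:E).
  apply/measurable_EFinP/measurable_funB; last first.
    by apply: measurable_funM => //; exact/measurable_EFinP.
  apply: measurable_funD => //; apply: measurable_funM => //.
  exact/measurable_EFinP.
(* The residual subtracted inside the nonnegative [b] is added back under the integral, where it
   cancels pointwise. *)
apply: (@le_trans _ _ (\int[P]_t (b t)%:E + (w k)%:E * rho k)%E).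
  rewrite leeD2r//; apply: ae_le_integral_lower => //.
    by move=> t; exact: integral_ge0.
  exact: aeW.
have r0 t : (0 <= (r t)%:E)%E by rewrite lee_fin sqr_ge0.
have -> : ((w k)%:E * rho k = \int[P]_t ((w k)%:E * (r t)%:E))%E.
  by rewrite ge0_integralZl_EFin.
rewrite -ge0_integralD//; last 2 first.
- by move=> t _; rewrite mule_ge0.
- exact: measurable_funeM.
under eq_integral do rewrite -EFinM -EFinD /b subrK EFinD EFinM.
rewrite ge0_integralD//; last 3 first.
- by move=> t _; rewrite mule_ge0// lee_fin ?sqr_ge0// ltW.
- exact: measurable_funeM.
- by move=> t _; rewrite lee_fin mulr_ge0 ?sqr_ge0// mulr_ge0 ?sqr_ge0.
rewrite integral_cst// [X in (_ * X)%E]probability_setT mule1.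
by rewrite ge0_integralZl_EFin//; exact: ltW.
Qed.

Let w_gt0 k : 0 < w k.
Proof. by have /andP[l0 l1] := lambda01 k; rewrite mulr_gt0// subr_gt0. Qed.

Let a_ge0 k : (0 <= a k)%E.
Proof. by apply: integral_ge0 => t _; rewrite lee_fin sqr_ge0. Qed.

Let rho_ge0 k : (0 <= rho k)%E.
Proof. by apply: integral_ge0 => t _; rewrite lee_fin sqr_ge0. Qed.

Lemma km_second_moment_fin k : a k \is a fin_num.
Proof.
elim: k => [|k IH].
  by rewrite /a /x /= integral_cst// [X in (_ * X)%E]probability_setT mule1.
rewrite ge0_fin_numE//; apply: le_lt_trans (le_trans _ (km_recurrence k)) _.
  by rewrite leeDl// mule_ge0// lee_fin ltW.
by rewrite -(fineK IH) -EFinM -EFinD ltry.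
Qed.

Lemma km_residual_fin k : rho k \is a fin_num.
Proof.
rewrite ge0_fin_numE//.
have : ((w k)%:E * rho k < +oo)%E.
  apply: le_lt_trans (le_trans _ (km_recurrence k)) _; first by rewrite leeDr.
  by rewrite -(fineK (km_second_moment_fin k)) -EFinM -EFinD ltry.
by case: (rho k) (rho_ge0 k) => // [r|_]; rewrite ?ltry// gt0_muley// lte_fin.
Qed.

Lemma km_discounted_residual_le K :
  \sum_(k < K) Lambda lambda k.+1 * (w k * fine (rho k)) <=
  `|x0 - p| ^+ 2 + \sum_(k < K) 2 * lambda k ^+ 2 * sigma ^+ 2.
Proof.
have -> : `|x0 - p| ^+ 2 = fine (a 0%N).
  by rewrite /a /x /= integral_cst// [X in (_ * X)%E]probability_setT mule1.
apply: (@discounted_sum_le _ lambda (fun k => fine (a k))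
  (fun k => w k * fine (rho k))
  (fun k => 2 * lambda k ^+ 2 * sigma ^+ 2)) => k.
- exact: fine_ge0.
- by rewrite mulr_ge0 ?sqr_ge0// mulr_ge0 ?sqr_ge0.
rewrite -lee_fin !EFinD !EFinM !fineK ?km_second_moment_fin ?km_residual_fin//.
exact: km_recurrence.
Qed.

End fixed_point.

Variables (p0 : H) (sigma : R).
Hypothesis Mp0 : M p0 = p0.
Hypothesis variance_le :
  (\int[D]_z (`|T z p0 - p0| ^+ 2)%:E <= (sigma ^+ 2)%:E)%E.

Definition km_residual k : R := \int[P]_t `|M (x k t) - x k t| ^+ 2.

Lemma has_Rintegral_km_residual k :
  has_Rintegral P (fun t => `|M (x k t) - x k t| ^+ 2) (km_residual k).
Proof.
split=> //; apply/integrableP; split.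
  by apply/measurable_EFinP/measurable_funX; exact: measurable_residual.
under eq_integral do rewrite gee0_abs ?lee_fin ?sqr_ge0//.
by have := km_residual_fin Mp0 variance_le k; rewrite fin_numElt => /andP[].
Qed.

(** The estimate holds with [|x0 - p| ^ 2] for each fixed point [p]. As [dist] is an infimum of
    norms and not of squares, [Num.sqrt A] is compared with it, after the trivial case [A <= 0]. *)
Lemma km_discounted_residual_dist_le K :
  \sum_(k < K) Lambda lambda k.+1 * lambda k * (1 - lambda k) * km_residual k <=
  dist x0 (Fix M) ^+ 2 + 2 * \sum_(k < K) lambda k ^+ 2 * sigma ^+ 2.
Proof.
rewrite -lerBlDr; set A := _ - _.
have Ap p : M p = p -> A <= `|x0 - p| ^+ 2.
  move=> Mp; rewrite lerBlDr.
  have vp := variance_le.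
  rewrite (variance_fixed_point dotE H_separable T_nonexpansive T_measurable
    T_mean Mp0 Mp) in vp.
  have := km_discounted_residual_le Mp vp K.
  rewrite big_distrr/=; under [X in _ <= _ + X]eq_bigr do rewrite -mulrA.
  by under eq_bigr do rewrite !mulrA.
have [A0|A0] := leP A 0; first by rewrite (le_trans A0)// sqr_ge0.
have Ad : Num.sqrt A <= dist x0 (Fix M).
  apply: lb_le_inf; first by exists `|x0 - p0|, p0.
  move=> _ [p Mp <-]; rewrite -(@ler_pXn2r _ 2) ?nnegrE ?sqrtr_ge0//.
  by rewrite sqr_sqrtr ?(ltW A0)// Ap.
rewrite -(sqr_sqrtr (ltW A0)) ler_pXn2r ?nnegrE ?sqrtr_ge0//.
exact: le_trans (sqrtr_ge0 A) Ad.
Qed.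

End km_process.

(** The integrand is split by indicators according to the value of [N], and independence factors
    each term. *)
Lemma integral_random_index {R : realType} {d} {Omega : measurableType d}
    (P : probability Omega R) {dU} {U : measurableType dU} (X : nat -> Omega -> U)
    (N : {RV P >-> nat}) (f : U -> R) K :
  (forall k, measurable_fun setT (X k)) ->
  (forall k A B, measurable A ->
    P (X k @^-1` A `&` N @^-1` B) = (P (X k @^-1` A) * P (N @^-1` B))%E) ->
  (forall w, (N w < K)%N) -> measurable_fun setT f -> (forall u, 0 <= f u) ->
  (\int[P]_w (f (X (N w) w))%:E =
   \sum_(k < K) P (N @^-1` [set nat_of_ord k]) * \int[P]_w (f (X k w))%:E)%E.
Proof.
move=> mX indep NK mf f0.
pose phi k (u : U * nat) : \bar R := (f u.1 * \1_[set k] u.2)%:E.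
have mphi k : measurable_fun setT (phi k).
  apply/measurable_EFinP/measurable_funM; first exact: (measurableT_comp mf).
  by apply: measurableT_comp; [exact: measurable_indic|exact: measurable_snd].
have phi0 k u : (0 <= phi k u)%E by rewrite lee_fin mulr_ge0.
have -> : (\int[P]_w (f (X (N w) w))%:E =
    \int[P]_w \sum_(k < K) phi k (X k w, N w))%E.
  apply: eq_integral => w _; rewrite (bigD1 (Ordinal (NK w)))//= big1 ?adde0.
    by rewrite /phi /= indicE mem_set// mulr1.
  move=> k kN; rewrite /phi /= indicE memNset ?mulr0// => Nk.
  by move/eqP : kN; apply; apply/val_inj; rewrite /= Nk.
rewrite (ge0_integral_sum P measurableT)//; last first.
  move=> k; apply: (measurableT_comp (mphi k)).
  exact: measurable_fun_pair.
apply: eq_bigr => k _.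
rewrite (integral_independent_pair (mX k) _ (mphi k) (phi0 k)); last first.
  by move=> A B mA _; exact: indep.
pose q := fine (P (N @^-1` [set nat_of_ord k])).
have Pk : q%:E = P (N @^-1` [set nat_of_ord k]).
  by rewrite fineK// fin_num_measure//; exact: measurable_funPTI.
transitivity (\int[P]_w (q%:E * (f (X k w))%:E))%E.
  apply: eq_integral => w _; rewrite /phi/=; under eq_integral do rewrite EFinM.
  rewrite ge0_integralZl_EFin//.
  by rewrite integral_indic// setIT muleC Pk.
rewrite ge0_integralZl_EFin//.
- by rewrite Pk.
- by move=> w _; rewrite lee_fin.
- by apply/measurable_EFinP; exact: (measurableT_comp mf).
- exact: fine_ge0.
Qed.

(** * The random index and almost sure statements *)

Lemma measurable_random_index {d} {Omega : measurableType d} {dU}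
    {U : measurableType dU} (X : nat -> Omega -> U) (N : Omega -> nat) :
  (forall k, measurable_fun setT (X k)) -> measurable_fun setT N ->
  measurable_fun setT (fun w => X (N w) w).
Proof.
move=> mX mN _ A mA; rewrite setTI.
have -> : (fun w => X (N w) w) @^-1` A = \bigcup_k (N @^-1` [set k] `&` X k @^-1` A).
  apply/seteqP; split => [w Aw|w [k _ [/= <-]]//].
  by exists (N w).
apply: bigcupT_measurable => k; rewrite -[X in measurable X]setTI setIIr.
by apply: measurableI; [exact: mN|exact: mX].
Qed.

Lemma ae_preimage {R : realType} {d} {Omega : measurableType d}
    (P : probability Omega R) {dU} {U : measurableType dU} (D : probability U R)
    (X : {RV P >-> U}) (Q : U -> Prop) :
  (forall A, measurable A -> distribution P X A = D A) ->
  {ae D, forall u, Q u} -> {ae P, forall w, Q (X w)}.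
Proof.
move=> XD [A [mA DA QA]]; exists (X @^-1` A); split => [||w nQ].
- exact: measurable_funPTI.
- by have := XD _ mA; rewrite DA.
- exact: QA.
Qed.

Lemma ae_eq_has_Rintegral {R : realType} {d} {X : measurableType d}
    (mu : probability X R) (f g : X -> R) a :
  measurable_fun setT f -> {ae mu, forall x, f x = g x} ->
  has_Rintegral mu g a -> has_Rintegral mu f a.
Proof.
move=> mf fg [intg <-]; split; last first.
  congr fine; apply: ae_eq_integral => //.
  - exact/measurable_EFinP.
  - exact: measurable_int intg.
  - by apply: filterS fg => x -> _.
apply/integrableP; split; first exact/measurable_EFinP.
move/integrableP : (intg) => [mg]; apply: le_lt_trans.
rewrite le_eqVlt; apply/orP; left; apply/eqP; apply: ae_eq_integral => //.
- exact/measurableT_comp/measurable_EFinP.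
- exact: measurableT_comp.
- by apply: filterS fg => x /= -> _.
Qed.

Lemma nonexpansive_modification {R : realType} {V : normedModType R} {d}
    {Xi : measurableType d} (D : probability Xi R) (T : Xi -> V -> V) :
  {ae D, forall z, nonexpansive (T z)} ->
  (forall x, measurable_fun [set: Xi] (fun z => T z x : borelType V)) ->
  exists S : Xi -> V -> V, [/\ forall z, nonexpansive (S z),
    forall x, measurable_fun [set: Xi] (fun z => S z x : borelType V) &
    {ae D, forall z, S z = T z}].
Proof.
(* [Z] is a measurable null set containing the bad parameters. Modifying on all of [Z] preserves
   measurability, since the set of bad parameters itself need not be measurable. *)
move=> [Z [mZ DZ TZ]] mT; exists (fun z => if z \in Z then id else T z); split.
- move=> z; case: ifPn => [_ x y//|nZ]; apply: contrapT => nT.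
  by move/negP : nZ; apply; apply/mem_set; exact: TZ.
- move=> x.
  rewrite (_ : (fun z => _) = (fun z => if z \in Z then x else T z x)); last first.
    by apply/funext => z; case: ifP.
  apply: measurable_fun_ifT => //.
  by apply: (measurable_fun_bool true); rewrite setTI preimage_mem_true.
- exists Z; split => // z /= nS; apply: contrapT => nZ; apply: nS.
  by rewrite memNset.
Qed.

(** By monotone convergence the series has integral at most [B], so it is almost surely finite and
    bounds its own partial sums. *)
Lemma ae_bounded_sum {R : realType} {d} {Omega : measurableType d}
    (P : probability Omega R) (f : nat -> Omega -> R) (rho : nat -> R) B :
  (forall k w, 0 <= f k w) -> (forall k, has_Rintegral P (f k) (rho k)) ->
  (forall K, \sum_(k < K) rho k <= B) ->
  {ae P, forall w, exists b, forall K, \sum_(k < K) f k w <= b}.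
Proof.
move=> f0 fr rB.
have mf k : measurable_fun setT (fun w => (f k w)%:E).
  by have [+ _] := fr k; exact: measurable_int.
pose g w : \bar R := (\sum_(0 <= k <oo) (f k w)%:E)%E.
have g0 w : (0 <= g w)%E by apply: nneseries_ge0 => k _ _; rewrite lee_fin.
have intg : P.-integrable setT g.
  apply/integrableP; split.
    apply: (@ge0_emeasurable_sum _ _ _ _ (fun k w => (f k w)%:E) xpredT) => //.
    by move=> k w _ _; rewrite lee_fin.
  under eq_integral do rewrite gee0_abs//.
  rewrite integral_nneseries//; last by move=> k w _; rewrite lee_fin.
  apply: (@le_lt_trans _ _ B%:E); last exact: ltry.
  apply: lime_le.
    apply: is_cvg_nneseries => k _ _.
    by apply: integral_ge0 => w _; rewrite lee_fin.
  apply: nearW => K; rewrite big_mkord.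
  by under eq_bigr do rewrite (has_RintegralE (fr _)); rewrite sumEFin lee_fin.
apply: filterS (integrable_ae measurableT intg) => w /(_ I) gfin.
exists (fine (g w)) => K; rewrite -lee_fin fineK// -sumEFin.
rewrite -(big_mkord xpredT (fun k => (f k w)%:E)).
by apply: nneseries_lim_ge => k _ _; rewrite lee_fin.
Qed.

(** The sum of [lambda k * (1 - lambda k)] differs from the divergent sum of [lambda k] by at most
    the sum of squares. *)
Lemma cvg_weight_sum {R : realType} (lambda : nat -> R) :
  (\sum_(0 <= k <oo) (lambda k ^+ 2)%:E < +oo)%E ->
  (\sum_(0 <= k <oo) (lambda k)%:E = +oo)%E ->
  (forall k, 0 <= lambda k) ->
  (forall K, \sum_(k < K) lambda k ^+ 2 <=
    fine (\sum_(0 <= k <oo) (lambda k ^+ 2)%:E)%E) /\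
  (fun K => \sum_(k < K) lambda k * (1 - lambda k)) @ \oo --> +oo.
Proof.
move=> l2 l1 l0; set s := fine _.
have l2s K : \sum_(k < K) lambda k ^+ 2 <= s.
  rewrite -lee_fin fineK; last first.
    by rewrite ge0_fin_numE// nneseries_ge0// => k _ _; rewrite lee_fin sqr_ge0.
  rewrite -sumEFin -(big_mkord xpredT (fun k => (lambda k ^+ 2)%:E)).
  by apply: nneseries_lim_ge => k _ _; rewrite lee_fin sqr_ge0.
split => //; apply/cvgryPge => A.
have : (fun n => \sum_(0 <= k < n) (lambda k)%:E)%E @ \oo --> +oo%E.
  rewrite -l1; apply: is_cvg_nneseries => k _ _; by rewrite lee_fin.
move=> /cvgeyPge /(_ (A + s)); apply: filterS => K.
rewrite big_mkord sumEFin lee_fin => AK.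
under eq_bigr do rewrite mulrBr mulr1 -expr2.
by rewrite sumrB; have := l2s K; lra.
Qed.

Unset Implicit Arguments.
Set Strict Implicit.

Theorem mainTheorem3 (R : realType) (H : completeNormedModType R)
  (dot : {dot H for idfun}) (H_dot : forall x : H, dot x x = `|x| ^+ 2)
  (H_separable : separable H)
  (dXi : measure_display) (Xi : measurableType dXi) (D : probability Xi R)
  (T : Xi -> H -> H)
  (T_nonexpansive : {ae D, forall z, nonexpansive (T z)})
  (T_measurable : forall x : H,
     measurable_fun [set: Xi] (fun z => T z x : borelType H))
  (T_integrable : forall x : H, bochner_integrable D (fun z => T z x))
  (Fix_neq0 : Fix (mean_operator D T) !=set0)
  (p0 : H) (p0_Fix : Fix (mean_operator D T) p0)
  (sigma : R)
  (p0_sigma : ('E_D[fun z => (`|T z p0 - mean_operator D T p0| ^+ 2)%R]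
               <= (sigma ^+ 2)%:E)%E)
  (lambda : nat -> R) (lambda01 : forall k, 0 < lambda k < 1)
  (x0 : H)
  (dO : measure_display) (Omega : measurableType dO) (P : probability Omega R)
  (xi : nat -> {RV P >-> Xi})
  (xi_law : forall k (A : set Xi), measurable A ->
     distribution P (xi k) A = D A)
  (xi_independent : mutually_independent xi)
  (N : nat -> {RV P >-> nat})
  (N_range : forall K w, (0 < K)%N -> (N K w < K)%N)
  (N_law : forall K k, (k < K)%N ->
     P [set w | N K w = k] =
     (Lambda lambda k.+1 * lambda k * (1 - lambda k) /
      \sum_(j < K) Lambda lambda j.+1 * lambda j * (1 - lambda j))%:E)
  (N_independent : forall K, (0 < K)%N ->
     independent_sigma_algebras P (g_sigma_algebra_preimage (N K))
       (sigma_of_sequence xi)) :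
  let x k w := km_iter T lambda x0 (fun i => xi i w) k in
  let r k w := `|mean_operator D T (x k w) - x k w| in
  let S K := \sum_(k < K) lambda k * (1 - lambda k) in
  (forall K, (0 < K)%N ->
     ('E_P[fun w => (r (N K w) w ^+ 2)%R] <=
      ((dist x0 (Fix (mean_operator D T)) ^+ 2
        + 2 * \sum_(k < K) lambda k ^+ 2 * sigma ^+ 2)
       / (Lambda lambda K * S K))%:E)%E)
  /\
  ((\sum_(0 <= k <oo) (lambda k ^+ 2)%:E < +oo)%E ->
   (\sum_(0 <= k <oo) (lambda k)%:E = +oo)%E ->
   (exists C : R, forall K, (0 < K)%N ->
      ('E_P[fun w => r (N K w) w] <= (C / Num.sqrt (S K))%:E)%E)
   /\
   {ae P, forall w,
      (fun K => running_min (fun k => r k w) K : R^o)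
      =o_\oo (fun K => (Num.sqrt (S K))^-1 : R^o)}).
Proof.
move=> x r S.
pose M := mean_operator D T.
have [T' [T'ne T'm T'T]] := nonexpansive_modification T_nonexpansive T_measurable.
have T'mean y u : has_Rintegral D (fun z => dot (T' z y) u) (dot (M y) u).
  have := bochner_integrable_dot H_dot H_separable u (T_measurable y)
    (T_integrable y).
  apply: ae_eq_has_Rintegral; first exact: measurable_dot.
  by apply: filterS T'T => z ->.
have variance_le : (\int[D]_z (`|T' z p0 - p0| ^+ 2)%:E <= (sigma ^+ 2)%:E)%E.
  apply: le_trans p0_sigma; rewrite unlock.
  rewrite le_eqVlt; apply/orP; left; apply/eqP; apply: ae_eq_integral => //.
  - by apply/measurable_EFinP; exact: measurable_noise.
  - apply/measurable_EFinP/measurable_funX/measurable_norm_sub => //.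
  by apply: filterS T'T => z -> _; rewrite [in RHS]p0_Fix.
pose X k w := km_iter T' lambda x0 (fun i => xi i w) k.
(* Countably many null sets are discarded: almost surely no draw is a modified parameter, so both
   trajectories coincide at all times. *)
have X_ae : {ae P, forall w k, X k w = x k w}.
  have : {ae P, forall w k, T' (xi k w) = T (xi k w)}.
    by apply: ae_foralln => k; exact: (ae_preimage (xi_law k) T'T).
  apply: filterS => w TT; elim=> [//|k IH].
  by rewrite /X /x /= -/(X k w) -/(x k w) IH TT.
have mX k : measurable_fun setT (X k : Omega -> borelType H).
  exact: (measurable_km_iter H_separable).
pose f (y : borelType H) : R := `|M y - y| ^+ 2.
have mf : measurable_fun setT f.
  apply: measurable_funX.
  exact: (measurable_residual H_dot H_separable T'ne T'mean).
pose rho k := \int[P]_w f (X k w).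
have rhoE k : has_Rintegral P (fun w => f (X k w)) (rho k).
  exact: (has_Rintegral_km_residual H_dot H_separable T'ne T'm T'mean x0 lambda01
    xi_law xi_independent p0_Fix variance_le).
have rho_ge0 k : 0 <= rho k by apply: Rintegral_ge0 => w _; rewrite sqr_ge0.
pose B K := dist x0 (Fix M) ^+ 2 + 2 * \sum_(k < K) lambda k ^+ 2 * sigma ^+ 2.
have rhoB K :
    \sum_(k < K) Lambda lambda k.+1 * lambda k * (1 - lambda k) * rho k <= B K.
  exact: (km_discounted_residual_dist_le H_dot H_separable T'ne T'm T'mean x0
    lambda01 xi_law xi_independent p0_Fix variance_le).
have w_gt0 k : 0 < lambda k * (1 - lambda k).
  by have /andP[l0 l1] := lambda01 k; rewrite mulr_gt0// subr_gt0.
have S_gt0 K : (0 < K)%N -> 0 < S K.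
  case: K => // K _; rewrite /S big_ord_recl ltr_pwDl// sumr_ge0// => k _.
  exact: ltW.
have B_ge0 K : 0 <= B K.
  rewrite addr_ge0 ?sqr_ge0// mulr_ge0// sumr_ge0// => k _.
  by rewrite mulr_ge0 ?sqr_ge0.
have f0 y : 0 <= f y by rewrite sqr_ge0.
(* The normalising constant of the law of [N K] is bounded below because [Lambda] is
   nonincreasing. *)
have LS K : Lambda lambda K * S K <=
    \sum_(j < K) Lambda lambda j.+1 * lambda j * (1 - lambda j).
  rewrite big_distrr/=; apply: ler_sum => k _; rewrite -mulrA ler_pM2r//.
  exact: Lambda_nonincreasing.
have mXN K : measurable_fun setT (fun w => f (X (N K w) w)).
  by apply: (measurableT_comp mf); exact: measurable_random_index.
have EfN K : (0 < K)%N ->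
    (\int[P]_w (f (X (N K w) w))%:E <= (B K / (Lambda lambda K * S K))%:E)%E.
  move=> K0.
  rewrite (integral_random_index (K := K) mX _ (fun w => N_range K w K0) mf f0).
    under eq_bigr => k _ do
      rewrite (N_law K k (ltn_ord k)) (has_RintegralE (rhoE k)) -EFinM.
    rewrite sumEFin lee_fin; under eq_bigr do rewrite mulrAC.
    rewrite -mulr_suml ler_pM//.
    - apply: sumr_ge0 => k _; rewrite mulr_ge0// -mulrA mulr_ge0 ?ltW//.
      exact: Lambda_gt0.
    - by rewrite invr_ge0 (le_trans _ (LS K))// mulr_ge0 ?ltW ?S_gt0 ?Lambda_gt0.
    have LS0 : 0 < Lambda lambda K * S K by rewrite mulr_gt0 ?S_gt0 ?Lambda_gt0.
    by rewrite lef_pV2// posrE (lt_le_trans LS0).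
  move=> k A C mA; rewrite setIC [RHS]muleC; apply: (N_independent K K0).
    by exists C => //; rewrite setTI.
  (* The iterates are measurable for the sigma-algebra of the draws, from which [N K] is
     independent. *)
  have := @measurable_km_iter _ _ H_separable _ _ _ T'ne T'm _ x0 lambda01 _
    (g_sigma_algebraType (\bigcup_k g_sigma_algebra_preimage (xi k))) k xi
    (fun j _ => measurable_sigma_of_sequence (xi := xi) j).
  by move=> /(_ measurableT A mA); rewrite setTI.
split.
  move=> K K0; rewrite unlock; apply: le_trans (EfN K K0).
  (* The residual along the original iterates is compared with its measurable version along [X]. *)
  apply: ae_le_integral_lower => //.
  - by move=> w; rewrite lee_fin sqr_ge0.
  - by move=> w; rewrite lee_fin.
  - exact/measurable_EFinP.
  - by apply: filterS X_ae => w Xw; rewrite /f /r Xw.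
move=> l2 l1.
have lambda_ge0 k : 0 <= lambda k by have /andP[/ltW] := lambda01 k.
have [l2s Soo] := cvg_weight_sum l2 l1 lambda_ge0.
(* [L] bounds every [Lambda lambda K] from below and [C] every numerator [B K] from above, both
   independently of [K]. *)
set s := fine _ in l2s; pose L := expR (- (2 * s)).
have LL K : L <= Lambda lambda K by exact: Lambda_ge_expR.
have L0 : 0 < L by exact: expR_gt0.
pose C := dist x0 (Fix M) ^+ 2 + 2 * (s * sigma ^+ 2).
have BC K : B K <= C.
  rewrite /B /C lerD2l ler_pM2l// -mulr_suml ler_wpM2r ?sqr_ge0//.
split.
  (* With [q = Num.sqrt (S K)], the inequality [t <= q / 2 * t ^ 2 + 1 / (2 q)] and the
     second-moment bound [C / (L q ^ 2)] give [(C / L + 1) / (2 q)]; this stands in for Jensen's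
     inequality. *)
  exists ((C / L + 1) / 2) => K K0; rewrite unlock.
  have SK := S_gt0 K K0; pose q := Num.sqrt (S K).
  have q0 : 0 < q by rewrite sqrtr_gt0.
  have amgm (t : R) : t <= q / 2 * t ^+ 2 + q^-1 / 2.
    rewrite -subr_ge0.
    have -> : q / 2 * t ^+ 2 + q^-1 / 2 - t = q^-1 / 2 * (q * t - 1) ^+ 2.
      by field; rewrite gt_eqF.
    by rewrite mulr_ge0 ?sqr_ge0// divr_ge0// invr_ge0 ltW.
  apply: (@le_trans _ _
    (\int[P]_w ((q / 2)%:E * (f (X (N K w) w))%:E + (q^-1 / 2)%:E))%E).
    apply: ae_le_integral_lower.
    - by move=> w; rewrite lee_fin normr_ge0.
    - by move=> w; rewrite -EFinM -EFinD lee_fin (le_trans (normr_ge0 _) (amgm _)).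
    - apply: emeasurable_funD => //; apply: measurable_funeM.
      exact/measurable_EFinP.
    - by apply: filterS X_ae => w Xw; rewrite -EFinM -EFinD lee_fin /f Xw amgm.
  have q2 : 0 <= q / 2 by rewrite divr_ge0 ?ltW.
  rewrite ge0_integralD//; last 3 first.
  - by move=> w _; rewrite mule_ge0 ?lee_fin.
  - by apply: measurable_funeM; exact/measurable_EFinP.
  - by move=> w _; rewrite lee_fin divr_ge0// invr_ge0 ltW.
  rewrite integral_cst// [X in (_ * X)%E]probability_setT mule1.
  rewrite ge0_integralZl_EFin//;
    [|by move=> w _; rewrite lee_fin|exact/measurable_EFinP].
  have EfC : (\int[P]_w (f (X (N K w) w))%:E <= (C / (L * q ^+ 2))%:E)%E.
    apply: le_trans (EfN K K0) _; rewrite lee_fin sqr_sqrtr ?(ltW SK)// ler_pM//.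
      by rewrite invr_ge0 ltW// mulr_gt0 ?Lambda_gt0.
    by rewrite lef_pV2 ?posrE ?mulr_gt0 ?Lambda_gt0// ler_pM2r.
  apply: (@le_trans _ _ ((q / 2)%:E * (C / (L * q ^+ 2))%:E + (q^-1 / 2)%:E)%E).
    by rewrite leeD2r// lee_wpmul2l// lee_fin.
  rewrite -EFinM -EFinD lee_fin -/q le_eqVlt; apply/orP; left; apply/eqP.
  by field; rewrite !gt_eqF.
(* Replacing each discount by its lower bound [L] gives an undiscounted bound uniform in [K], hence
   almost surely bounded partial sums. *)
have wrho K : \sum_(k < K) lambda k * (1 - lambda k) * rho k <= C / L.
  rewrite ler_pdivlMr// mulr_suml; apply: le_trans (le_trans (rhoB K) (BC K)).
  apply: ler_sum => k _; rewrite mulrC -!mulrA ler_wpM2r//.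
  by rewrite mulrA mulr_ge0// ltW.
have := ae_bounded_sum (f := fun k w => lambda k * (1 - lambda k) * f (X k w))
  (rho := fun k => lambda k * (1 - lambda k) * rho k) (P := P) (B := C / L).
move=> /(_ _ _ wrho) bounded.
have {}bounded : {ae P, forall w, exists b, forall K,
    \sum_(k < K) lambda k * (1 - lambda k) * f (X k w) <= b}.
  apply: bounded => k; last exact: has_RintegralZ.
  by move=> w; rewrite mulr_ge0// ltW.
near=> w.
have Xw : forall k, X k w = x k w by near: w.
have [b wb] : exists b, forall K,
    \sum_(k < K) lambda k * (1 - lambda k) * f (X k w) <= b.
  by near: w.
apply: (@running_min_littleo _ (fun k => lambda k * (1 - lambda k)) (r^~ w) b).
- by move=> k; exact: ltW.
- by move=> k; exact: normr_ge0.
- move=> K; apply: le_trans (wb K); rewrite le_eqVlt; apply/orP; left; apply/eqP.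
  by apply: eq_bigr => k _; rewrite /f /r Xw.
- exact: Soo.
Unshelve. all: by end_near.
Qed.
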